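(* For every $n\ge 1$, on the monoid $\mathcal{DORP}_n$ Green's relations satisfy $\mathcal{D}=\mathcal{L}$.
   Context: Let $[n]=\{1,\dots,n\}$ with its usual order. A partial transformation of $[n]$ is a function $\rho$ whose domain $\mathrm{Dom}\,\rho$ and image $\mathrm{Im}\,\rho$ are subsets of $[n]$ (the empty map is allowed). Maps are written on the right and composed left to right: $x(\rho\sigma)=(x\rho)\sigma$. $\rho$ is isotone if $x\le y$ implies $x\rho\le y\rho$ for all $x,y\in\mathrm{Dom}\,\rho$; antitone if $x\le y$ implies $x\rho\ge y\rho$; monotone if isotone or antitone; decreasing if $x\rho\le x$ for all $x\in\mathrm{Dom}\,\rho$. $\mathcal{DORP}_n$ is the monoid, under composition, of all monotone and decreasing partial transformations of $[n]$. Green's relations on a semigroup $S$: $g\,\mathcal{L}\,h$ iff $S^1g=S^1h$; $g\,\mathcal{R}\,h$ iff $gS^1=hS^1$; $\mathcal{D}$ is the join of $\mathcal{L}$ and $\mathcal{R}$ in the lattice of equivalence relations. *)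

(* Defs.v *)
From HB Require Import structures.
From mathcomp Require Import all_boot.
From Stdlib Require Export RelationClasses.

Set Implicit Arguments.
Unset Strict Implicit.
Unset Printing Implicit Defensive.

Local Open Scope group_scope.

Section Green.

Variable S : semigroupType.
Implicit Types (g h x : S) (E : S -> S -> Prop).

(* The ideals S^1 g = {g} U S g and g S^1 = {g} U g S; when S is a monoid,
   S^1 = S and these are S g and g S. *)
Definition left_ideal g x : Prop := x = g \/ exists s, x = s * g.
Definition right_ideal g x : Prop := x = g \/ exists s, x = g * s.

Definition green_L g h : Prop := forall x, left_ideal g x <-> left_ideal h x.
Definition green_R g h : Prop := forall x, right_ideal g x <-> right_ideal h x.

(* The join of L and R: the least equivalence relation containing both. *)
Definition green_D g h : Prop :=
  forall E, Equivalence E -> subrelation green_L E -> subrelation green_R E ->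
  E g h.

End Green.

(* Partial transformations of the n-element chain {0 < ... < n-1}, with
   f x = None when x is outside the domain of f. *)
Definition ptrans (n : nat) := {ffun 'I_n -> option 'I_n}.

HB.instance Definition _ n := Finite.on (ptrans n).

Section PartialTransformations.

Variable n : nat.
Implicit Types f g : ptrans n.

Definition pt_one : ptrans n := [ffun x => Some x].

(* Left-to-right composition: f is applied first. *)
Definition pt_mul f g : ptrans n := [ffun x => obind g (f x)].

Fact pt_mulA : associative pt_mul.
Proof.
move=> f g h; apply/ffunP=> x; rewrite !ffunE.
by case: (f x) => //= y; rewrite ffunE.
Qed.

Fact pt_mul1 : left_id pt_one pt_mul.
Proof. by move=> f; apply/ffunP=> x; rewrite !ffunE. Qed.

Fact pt_mulr1 : right_id pt_one pt_mul.
Proof.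
move=> f; apply/ffunP=> x; rewrite !ffunE.
by case: (f x) => //= y; rewrite ffunE.
Qed.

HB.instance Definition _ := isMonoid.Build (ptrans n) pt_mulA pt_mul1 pt_mulr1.

Definition isotone f : bool :=
  [forall x, forall y,
    if (f x, f y) is (Some a, Some b) then (x <= y) ==> (a <= b) else true].

Definition antitone f : bool :=
  [forall x, forall y,
    if (f x, f y) is (Some a, Some b) then (x <= y) ==> (b <= a) else true].

Definition monotone f : bool := isotone f || antitone f.

Definition decreasing f : bool :=
  [forall x, if f x is Some a then a <= x else true].

Definition monotone_decreasing : pred (ptrans n) :=
  fun f => monotone f && decreasing f.

Lemma pt_mulE f g x : (f * g) x = obind g (f x).
Proof. exact: ffunE. Qed.

Lemma isotoneP f :
  reflect (forall x y a b, f x = Some a -> f y = Some b -> x <= y -> a <= b)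
          (isotone f).
Proof.
apply: (iffP forallP) => [h x y a b fx fy | h x].
  by have /forallP/(_ y) := h x; rewrite fx fy => /implyP.
apply/forallP=> y; case fx: (f x) => [a|//]; case fy: (f y) => [b|//].
by apply/implyP; apply: h fx fy.
Qed.

Lemma antitoneP f :
  reflect (forall x y a b, f x = Some a -> f y = Some b -> x <= y -> b <= a)
          (antitone f).
Proof.
apply: (iffP forallP) => [h x y a b fx fy | h x].
  by have /forallP/(_ y) := h x; rewrite fx fy => /implyP.
apply/forallP=> y; case fx: (f x) => [a|//]; case fy: (f y) => [b|//].
by apply/implyP; apply: h fx fy.
Qed.

Lemma decreasingP f :
  reflect (forall x a, f x = Some a -> a <= x) (decreasing f).
Proof.
apply: (iffP forallP) => [h x a fx | h x]; first by have := h x; rewrite fx.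
by case fx: (f x) => [a|//]; apply: h fx.
Qed.

Fact monotone_decreasing_closed : monoid_closed monotone_decreasing.
Proof.
split=> [|f g].
  apply/andP; split; [apply/orP; left; apply/isotoneP | apply/decreasingP].
    by move=> x y a b; rewrite !ffunE => -[<-] [<-].
  by move=> x a; rewrite ffunE => -[<-].
case/andP=> mf /decreasingP df /andP[mg /decreasingP dg].
have mulP x a : (f * g) x = Some a -> exists2 y, f x = Some y & g y = Some a.
  by rewrite pt_mulE; case: (f x) => //= y gy; exists y.
apply/andP; split; last first.
  apply/decreasingP=> x a /mulP[y fx gy].
  exact: leq_trans (dg _ _ gy) (df _ _ fx).
apply/orP; case/orP: mf => [/isotoneP|/antitoneP] mf;
  case/orP: mg => [/isotoneP|/antitoneP] mg; [left|right|right|left];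
  (apply/isotoneP || apply/antitoneP);
  move=> x y a b /mulP[u fx gu] /mulP[v fy gv] le_xy;
  have le := mf _ _ _ _ fx fy le_xy;
  by [apply: mg gu gv le | apply: mg gv gu le].
Qed.

End PartialTransformations.

Record DORP (n : nat) := MkDORP {
  DORP_val :> ptrans n;
  DORP_valP : monotone_decreasing DORP_val
}.

HB.instance Definition _ n := [isSub for @DORP_val n].
HB.instance Definition _ n := [Finite of DORP n by <:].
HB.instance Definition _ n :=
  SubChoice_isSubMonoid.Build (ptrans n) (@monotone_decreasing n) (DORP n)
    (@monotone_decreasing_closed n).

(* Main.v *)
Require Import Defs.
From mathcomp Require Import all_boot.

(** Right multiplication by a decreasing map shrinks the domain and lowers every
    value. Hence two R-related elements have the same domain and the same
    values, so R is equality and its join with L is L. *)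

Local Open Scope group_scope.

Lemma green_L_equivalence (S : semigroupType) : Equivalence (@green_L S).
Proof.
split=> [g x | g h gLh x | g h k gLh hLk x] //; first exact: iff_sym.
exact: iff_trans (gLh x) (hLk x).
Qed.

Lemma right_ideal_DORP_le {n : nat} {g h : DORP n} {x a : 'I_n} :
  right_ideal h g -> DORP_val g x = Some a ->
  exists2 b, DORP_val h x = Some b & a <= b.
Proof.
case=> [-> hx | [s ->]]; first by exists a.
(* The product of [DORP n] is by conversion that of [ptrans n]. *)
have -> : DORP_val (h * s) x = obind (DORP_val s) (DORP_val h x).
  exact: pt_mulE.
case: (DORP_val h x) => //= b sb; exists b => //.
by have /andP[_ /decreasingP ds] := DORP_valP s; apply: ds sb.
Qed.

(** Each element lies in the right ideal of the other, so the bounds on domains and values hold both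
    ways and antisymmetry applies. *)
Lemma green_R_DORP_eq {n : nat} {g h : DORP n} : green_R g h -> g = h.
Proof.
move=> gRh.
have hg : right_ideal h g by apply/gRh; left.
have gh : right_ideal g h by apply/gRh; left.
apply: val_inj; apply/ffunP=> x; rewrite [LHS]/= [RHS]/=.
case gx: (DORP_val g x) => [a|].
  have [b hx le_ab] := right_ideal_DORP_le hg gx.
  have [c] := right_ideal_DORP_le gh hx.
  rewrite gx => -[<-] le_ba; rewrite hx.
  by congr Some; apply: val_inj; apply/eqP; rewrite eqn_leq le_ab.
case hx: (DORP_val h x) => [b|] //.
by have [c] := right_ideal_DORP_le gh hx; rewrite gx.
Qed.

Theorem theorem2p5 (n : nat) (n_ge1 : 1 <= n) (g h : DORP n) :
  green_D g h <-> green_L g h.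
Proof.
split=> [gDh | gLh E _ LE _]; last exact: LE.
(* Take [E := green_L] in the definition of the join: it contains R because R-related elements are
   equal and L is reflexive. *)
apply: gDh => // [|x y /green_R_DORP_eq ->]; first exact: green_L_equivalence.
by case: (green_L_equivalence (DORP n)).
Qed.
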